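(* Fix a positive integer $m$, and for each real number $\lambda$ let $R_\lambda$ be the Hermitian symmetric polynomial on $\mathbb{C}^2$ defined by $$R_\lambda(z,\overline w)=\langle z,w\rangle^{2m}-\lambda\,(z_1z_2\overline{w_1}\,\overline{w_2})^m .$$ Let $S_m=\{R_\lambda:\lambda\in\mathbb{R}\}$. Write $\mathcal{P}_k$ for $\mathcal{P}_k(\mathbb{C}^2)$. The following statements hold: (1) $R_\lambda\in\mathcal{P}_1$ if and only if $\lambda\le 2^{2m}$. (2) $R_\lambda\in\mathcal{P}_2$ if and only if $\lambda\le 2^{2m-1}$. (3) $R_\lambda\in\mathcal{P}_\infty$ if and only if $\lambda\le\binom{2m}{m}$. (4) For each integer $k>m$, $R_\lambda\in\mathcal{P}_k$ if and only if $R_\lambda\in\mathcal{P}_\infty$. (5) $R_\lambda\in\mathcal{P}_m$ only if $\lambda\le\binom{2m}{m}+2$. (6) $I(S_m)=m+1$.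
   Context: Here $\langle z,w\rangle=z_1\overline{w_1}+z_2\overline{w_2}$. For a complex manifold $M$ with complex conjugate manifold $M'$, a holomorphic function $R:M\times M'\to\mathbb{C}$ (written $R(z,\overline w)$, holomorphic in $z$ and antiholomorphic in $w$) is Hermitian symmetric if $R(z,\overline w)=\overline{R(w,\overline z)}$ for all $z,w\in M$; $\mathcal{P}_0(M)$ is the set of these. For a positive integer $N$, $\mathcal{P}_N(M)$ is the set of $R\in\mathcal{P}_0(M)$ such that $\sum_{i,j=1}^N R(z_i,\overline{z_j})a_i\overline{a_j}\ge 0$ for all $(z_1,\dots,z_N)\in M^N$, $a\in\mathbb{C}^N$; $\mathcal{P}_\infty(M)=\bigcap_{N\ge1}\mathcal{P}_N(M)$. For $S\subset\mathcal{P}_0(M)$, the stability index $I(S)$ is the smallest positive integer $k$ with $S\cap\mathcal{P}_k(M)=S\cap\mathcal{P}_\infty(M)$ (and $I(S)=\infty$ if there is none). *)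

(* Defs.v *)
From HB Require Import structures.
From mathcomp Require Import all_boot all_order all_algebra.
From mathcomp Require Import all_classical all_reals all_analysis.
From mathcomp.real_closed Require Export complex.

Set Implicit Arguments.
Unset Strict Implicit.
Unset Printing Implicit Defensive.

Import Order.TTheory GRing.Theory Num.Theory.
Import numFieldNormedType.Exports.

Local Open Scope classical_set_scope.
Local Open Scope ring_scope.

(* The topology of the modulus on R[i], as a normed space over itself; without
   it the generic instances for numeric fields do not apply to R[i]. *)
HB.instance Definition _ (R : realType) := NormedModule.copy R[i] R[i]^o.

(* A function M x M' -> C, with M = C^n and M' its complex conjugate, is
   represented by a map K : M -> M -> C: R(z, \bar w) is K z w. *)
Notation ckernel R n := ('rV[R[i]]_n -> 'rV[R[i]]_n -> R[i]).

Section Kernels.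
Variables (R : realType) (n : nat).
Local Notation C := R[i].
Local Notation M := 'rV[C]_n.
Implicit Type K : ckernel R n.

(* Joint complex (Frechet) differentiability on C^n x C^n in the coordinates
   (z, u) with u = \bar w. *)
Definition holomorphic_kernel K : Prop :=
  forall p : M * M,
    differentiable (fun q : M * M => K q.1 (map_mx Num.conj q.2)) p.

Definition hermitian_symmetric K : Prop :=
  forall z w : M, K z w = (K w z)^*.

Definition calP0 : set (ckernel R n) :=
  [set K | holomorphic_kernel K /\ hermitian_symmetric K].

(* On R[i], 0 <= x means that x is real and nonnegative. *)
Definition calP (N : nat) : set (ckernel R n) :=
  [set K | calP0 K /\
    forall (z : 'I_N -> M) (a : 'I_N -> C),
      0 <= \sum_(i < N) \sum_(j < N) K (z i) (z j) * a i * (a j)^*].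

Definition calPoo : set (ckernel R n) :=
  \bigcap_(N in [set N | (0 < N)%N]) calP N.

(* None stands for the value infinity. *)
Definition stability_index (S : set (ckernel R n)) : option nat :=
  let stable k := (0 < k)%N && `[< S `&` calP k = S `&` calPoo >] in
  if pselect (exists k, stable k) is left ex then Some (ex_minn ex) else None.

End Kernels.

Arguments calP0 {R n}.
Arguments calP {R n} N.
Arguments calPoo {R n}.

Section Family.
Variable R : realType.
Local Notation C := R[i].

Definition herm (z w : 'rV[C]_2) : C :=
  z 0 0 * (w 0 0)^* + z 0 1 * (w 0 1)^*.

Definition Rlam (m : nat) (lambda : R) : ckernel R 2 := fun z w =>
  herm z w ^+ (2 * m) -
  (lambda%:C)%C * (z 0 0 * z 0 1 * (w 0 0)^* * (w 0 1)^*) ^+ m.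

Definition Sfam (m : nat) : set (ckernel R 2) := range (Rlam m).

End Family.

Arguments Sfam R m : clear implicits.

(* Main.v *)
Require Import Defs.
From mathcomp Require Import all_boot all_order all_algebra.
From mathcomp Require Import cyclic cyclotomic separable ring zify.
From mathcomp Require Import all_classical all_reals all_analysis.

Set Implicit Arguments.
Unset Strict Implicit.
Unset Printing Implicit Defensive.

Import Order.TTheory GRing.Theory Num.Theory.
Import numFieldNormedType.Exports.

Local Open Scope classical_set_scope.
Local Open Scope ring_scope.

(** Write a point of C^2 as (x, y). For points (x_i, y_i) with weights a_i, put
      V_j = sum_i a_i x_i^(2m - j) y_i^j    (0 <= j <= 2m).
    Expanding <z,w>^(2m) by the binomial formula diagonalises the Hermitian
    form of R_lambda in these moments: its value is
      sum_j 'C(2m, j) |V_j|^2 - lambda |V_m|^2.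
    So R_lambda is in P_k exactly when lambda |V_m|^2 is at most the energy
    sum_j 'C(2m, j) |V_j|^2 for all moment sequences of k points
    ([calP_RlamE]), and every part of the theorem compares the middle moment
    of k points with their energy.

    Upper bounds on lambda come from the points (1, w^i), w a primitive k-th
    root of unity, with weights w^(-mi): only the moments with j = m mod k
    survive, and all of these equal k. Hence lambda is at most the sum of the
    'C(2m, j) over j = m mod k ([root_of_unity_bound]). This sum is 2^(2m) for
    k = 1, 2^(2m-1) for k = 2, at most 'C(2m, m) + 2 for k = m, and
    'C(2m, m) for k > m, where j = m is the only index left.

    Conversely, keeping only the term j = m in the energy gives P_oo for
    lambda <= 'C(2m, m). The case k = 1 is the arithmetic-geometric mean
    inequality. For k = 2 the 2 x 2 matrix of R_lambda at lambda = 2^(2m-1) has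
    entries X^m - T^m / 2 with X = <z_i,z_j>^2 and T four times the coordinate
    product, and the determinant inequality is proved by induction on the
    exponent from
      X^(n+1) - T^(n+1) / 2 = X (X^n - T^n / 2) + T^n (X - T) / 2
    ([two_point_offdiag_le]).

    That the index is m + 1 and not smaller needs a lambda > 'C(2m, m) for
    which R_lambda is still in P_m. The Hankel matrix (V_{l+k}), 0 <= l, k <= m,
    of at most m points is a sum of at most m matrices of rank one, hence
    singular. If V_m, which fills its antidiagonal, dominated all the other
    moments, it would be invertible. So the other moments control V_m
    ([middle_moment_le]), which leaves room for lambda = 'C(2m, m) + 1/m^2
    ([energy_gap]). *)

(** * Moments and energy *)

Definition moment (C : numClosedFieldType) (N : nat) (x y a : 'I_N -> C)
    (n j : nat) : C :=
  \sum_i a i * x i ^+ (n - j) * y i ^+ j.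

Definition energy (C : numClosedFieldType) (N : nat) (x y a : 'I_N -> C)
    (n : nat) : C :=
  \sum_(j < n.+1) 'C(n, j)%:R * `|moment x y a n j| ^+ 2.

Lemma sqr_norm_moment (C : numClosedFieldType) (N : nat) (x y a : 'I_N -> C)
    (n j : nat) :
  `|moment x y a n j| ^+ 2 =
  \sum_i \sum_l (x i * (x l)^* ) ^+ (n - j) * (y i * (y l)^* ) ^+ j
                * a i * (a l)^*.
Proof.
rewrite normCK /moment rmorph_sum mulr_suml; apply: eq_bigr => i _.
rewrite mulr_sumr; apply: eq_bigr => l _.
by rewrite !rmorphM !rmorphXn /= !exprMn; ring.
Qed.

(** Squared moments are the Hermitian forms of the rank-one kernels
    (x x')^(n-j) (y y')^j, and the binomial formula adds these up. *)
Lemma energyE (C : numClosedFieldType) (N : nat) (x y a : 'I_N -> C) (n : nat) :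
  energy x y a n =
  \sum_i \sum_l (x i * (x l)^* + y i * (y l)^* ) ^+ n * a i * (a l)^*.
Proof.
rewrite /energy.
under eq_bigr => j _ do rewrite sqr_norm_moment mulr_sumr.
rewrite exchange_big /=; apply: eq_bigr => i _.
under eq_bigr => j _ do rewrite mulr_sumr.
rewrite exchange_big /=; apply: eq_bigr => l _.
rewrite exprDn !mulr_suml; apply: eq_bigr => j _.
by rewrite -mulr_natl; ring.
Qed.

(** * Roots of unity *)

Lemma sum_expr_unity_root (F : fieldType) (k : nat) (y : F) : y ^+ k = 1 ->
  \sum_(i < k) y ^+ i = if y == 1 then k%:R else 0.
Proof.
move=> yk; case: eqP => [->|/eqP y1].
  by under eq_bigr do rewrite expr1n; rewrite sumr_const card_ord.
have := subrX1 y k; rewrite yk subrr => /esym/eqP.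
by rewrite mulf_eq0 subr_eq0 (negbTE y1) => /eqP.
Qed.

(** A splitting of 'X^n - 1 has n distinct roots by separability, and n distinct
    n-th roots of unity include a generator. *)
Lemma exists_prim_root (C : numClosedFieldType) (n : nat) : (0 < n)%N ->
  exists w : C, n.-primitive_root w.
Proof.
move=> n_gt0; pose p : {poly C} := 'X^n - 1.
have [r Dp] := closed_field_poly_normal p.
rewrite (monicP _) ?monicXnsubC // scale1r in Dp.
have rn1 : all n.-unity_root r by apply/allP=> z; rewrite -root_prod_XsubC -Dp.
have sz_r : (n < (size r).+1)%N.
  by rewrite -(size_prod_XsubC r id) -Dp size_XnsubC.
have [|z] := hasP (has_prim_root n_gt0 rn1 _ sz_r); last by exists z.
by rewrite -separable_prod_XsubC -Dp separable_Xn_sub_1 // pnatr_eq0 -lt0n.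
Qed.

(** The test configuration is (1, w^i) with weight w^(-mi): its j-th moment is
    the geometric sum of w^((j-m)i), which selects the indices j = m mod k. *)
Lemma root_of_unity_bound (C : numClosedFieldType) (m k : nat) (lam : C) :
  (0 < k)%N ->
  (forall x y a : 'I_k -> C,
     lam * `|moment x y a (2 * m) m| ^+ 2 <= energy x y a (2 * m)) ->
  lam <= \sum_(j < (2 * m).+1 | j == m %[mod k]) 'C(2 * m, j)%:R.
Proof.
move=> k0 H; have [w wP] := exists_prim_root C k0.
have wk := prim_expr_order wP.
have nw : `|w| = 1.
  by apply/eqP; rewrite -(@pexpr_eq1 _ `|w| k) // -normrX wk normr1.
have ww : w * w^* = 1 by rewrite -normCK nw expr1n.
pose x (i : 'I_k) : C := 1; pose y (i : 'I_k) := w ^+ i.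
pose a (i : 'I_k) := (w^* ^+ m) ^+ i.
have momE j : moment x y a (2 * m) j = if (j == m %[mod k])%N then k%:R else 0.
  have -> : (j == m %[mod k])%N = (w ^+ j * w^* ^+ m == 1).
    rewrite -(eq_prim_root_expr wP).
    have wm : w ^+ m * w^* ^+ m = 1 by rewrite -exprMn ww expr1n.
    have wm0 : w^* ^+ m != 0.
      by apply: contra_eq_neq wm => ->; rewrite mulr0 eq_sym oner_neq0.
    by rewrite -(inj_eq (mulIf wm0)) wm.
  rewrite -sum_expr_unity_root; last first.
    by rewrite exprMn !(exprAC _ _ k) -rmorphXn /= wk rmorph1 !expr1n mulr1.
  apply: eq_bigr => i _.
  by rewrite /a /x /y expr1n mulr1 exprMn (exprAC w) mulrC.
have := H x y a; rewrite /energy momE eqxx normr_nat.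
have -> : \sum_(j < (2 * m).+1) 'C(2 * m, j)%:R *
            `|moment x y a (2 * m) j| ^+ 2 =
          (\sum_(j < (2 * m).+1 | j == m %[mod k]) 'C(2 * m, j)%:R) * k%:R ^+ 2.
  rewrite mulr_suml [RHS]big_mkcond; apply: eq_bigr => j _.
  by rewrite momE; case: ifP; rewrite ?normr_nat // normr0 expr0n mulr0.
by rewrite ler_pM2r // exprn_gt0 // ltr0n.
Qed.

(** Add the expansions of (1 + 1)^(2m) and (-1)^m (1 - 1)^(2m): the terms of the
    wrong parity cancel and the others double. *)
Lemma sum_bin_parity (m : nat) : (0 < m)%N ->
  (\sum_(j < (2 * m).+1 | j == m %[mod 2]) 'C(2 * m, j) = 2 ^ (2 * m - 1))%N.
Proof.
move=> m0; apply/eqP; rewrite -(@eqn_pmul2l 2) // -expnS subn1 prednK ?muln_gt0 //.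
rewrite -(@eqr_nat int); apply/eqP.
rewrite natrM natr_sum big_mkcond mulr_sumr natrX.
transitivity (\sum_(j < (2 * m).+1)
  (1 ^+ (2 * m - j) * 1 ^+ j *+ 'C(2 * m, j) +
   (-1) ^+ m * (1 ^+ (2 * m - j) * (-1) ^+ j *+ 'C(2 * m, j)) : int)).
  apply: eq_bigr => j _; rewrite !expr1n !mul1r mulrnAr -exprD -signr_odd oddD.
  rewrite !modn2; case: (odd m); case: (odd j) => /=;
    rewrite ?expr0 ?expr1 ?mulNrn; ring.
rewrite big_split -mulr_sumr -!exprDn subrr expr0n muln_eq0 /=.
by rewrite (gtn_eqF m0) mulr0 addr0.
Qed.

(** The interval from 0 to 2m reaches only m to either side of m, so a modulus
    k > m isolates the central index. *)
Lemma sum_bin_mod_gt (m k : nat) : (m < k)%N ->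
  (\sum_(j < (2 * m).+1 | j == m %[mod k]) 'C(2 * m, j) = 'C(2 * m, m))%N.
Proof.
move=> mk; have mP : (m < (2 * m).+1)%N by rewrite ltnS leq_pmull.
rewrite (big_pred1 (Ordinal mP)) // => j.
rewrite -[RHS]val_eqE /= (modn_small mk); have jm : (j <= 2 * m)%N by rewrite -ltnS.
apply/eqP/eqP => [e|->]; last exact: modn_small.
case: (ltnP j k) => [jk|kj]; first by rewrite modn_small in e.
have := divn_eq j k; rewrite e => ej.
suff : (k + m <= j)%N by move: jm mk; lia.
by rewrite ej leq_add2r leq_pmull // divn_gt0 // (leq_ltn_trans _ mk).
Qed.

Lemma sum_bin_mod_eq (m : nat) : (0 < m)%N ->
  (\sum_(j < (2 * m).+1 | j == m %[mod m]) 'C(2 * m, j) <= 'C(2 * m, m) + 2)%N.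
Proof.
move=> m0.
have mP : (m < (2 * m).+1)%N by rewrite ltnS leq_pmull.
have nP : (2 * m < (2 * m).+1)%N by [].
rewrite (bigD1 (Ordinal mP)) //= leq_add2l.
apply: (@leq_trans (\sum_(j < (2 * m).+1)
          ((j == ord0) * 1 + (j == Ordinal nP) * 1))).
  rewrite big_mkcond; apply: leq_sum => j _.
  case: ifP => // /andP[/eqP e jm].
  have := divn_eq j m; rewrite e modnn addn0 => {}e.
  have jm2 : (j <= 2 * m)%N by rewrite -ltnS.
  have : (j %/ m < 3)%N by rewrite ltn_divLR //; lia.
  case: (j %/ m)%N e => [|[|[|//]]] e _.
  - by rewrite e mul0n bin0 -val_eqE /= e mul0n.
  - by move: jm; rewrite -val_eqE /= e mul1n eqxx.
  - by rewrite e binn -[in X in (_ <= _ + X)%N]val_eqE /= e eqxx leq_addl.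
by rewrite big_split /= -!big_distrl /= !muln1 -!big_mkcond !sum1_card !card1.
Qed.

(** * Lower bounds on the energy of few points *)

Lemma energy_ge_mid (C : numClosedFieldType) (N : nat) (x y a : 'I_N -> C)
    (m : nat) :
  'C(2 * m, m)%:R * `|moment x y a (2 * m) m| ^+ 2 <= energy x y a (2 * m).
Proof.
have mP : (m < (2 * m).+1)%N by rewrite ltnS leq_pmull.
rewrite /energy (bigD1 (Ordinal mP)) //= lerDl.
by apply: sumr_ge0 => j _; rewrite mulr_ge0 ?exprn_ge0.
Qed.

(** Hankel singularity in quantitative form. As N <= m there is a nonzero binary
    form of degree m, with coefficients u_k, vanishing at all N points; so
    sum_k u_k V_(l+k) = 0 for every l <= m. Choosing k0 with |u_k0| maximal
    and l = m - k0 puts V_m against the largest coefficient, and the m remaining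
    terms bound it. *)
Lemma middle_moment_le (C : numClosedFieldType) (N m : nat)
    (x y a : 'I_N -> C) (s : C) : (N <= m)%N ->
  (forall j, (j <= 2 * m)%N -> j != m -> `|moment x y a (2 * m) j| <= s) ->
  `|moment x y a (2 * m) m| <= m%:R * s.
Proof.
move=> Nm Hs.
pose A : 'M[C]_(m.+1, N) := \matrix_(k, i) (x i ^+ (m - k) * y i ^+ k).
have /rowV0Pn[u uA u0] : kermx A != 0.
  rewrite kermx_eq0 /row_free neq_ltn.
  by rewrite (leq_ltn_trans (rank_leq_col A)).
have {}uA i : \sum_k u 0 k * (x i ^+ (m - k) * y i ^+ k) = 0.
  have /sub_kermxP/matrixP/(_ 0 i) := uA; rewrite mxE [RHS]mxE => uAi.
  by apply: etrans uAi; apply: eq_bigr => k _; rewrite [A _ _]mxE.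
(* Norms are real, so a maximal one exists although C is not totally ordered. *)
have [k0 _ k0max] := @real_arg_maxP _ _ (ord0 : 'I_m.+1) predT
  (fun k => `|u 0 k|) isT (fun i _ => normr_real _).
have uk0 : 0 < `|u 0 k0|.
  case/rV0Pn: u0 => k uk; apply: lt_le_trans (k0max k isT).
  by rewrite normr_gt0.
have k0m : (k0 <= m)%N by rewrite -ltnS.
pose V k := moment x y a (2 * m) (m - k0 + k).
have uV : \sum_k u 0 k * V k = 0.
  (* The i-th point contributes the value of the form u at that point times
     the monomial of degree m with exponents k0 and m - k0. *)
  transitivity (\sum_i a i * x i ^+ k0 * y i ^+ (m - k0) *
      \sum_k u 0 k * (x i ^+ (m - k) * y i ^+ k)); last first.
    by apply: big1 => i _; rewrite uA mulr0.
  under eq_bigr => k _ do rewrite mulr_sumr.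
  rewrite exchange_big /=; apply: eq_bigr => i _; rewrite mulr_sumr.
  apply: eq_bigr => k _; have km : (k <= m)%N by rewrite -ltnS.
  have -> : (2 * m - (m - k0 + k) = k0 + (m - k))%N.
    by rewrite mul2n -addnn subnDA subnBA // addnAC addnK addnC addnBA.
  by rewrite !exprD; ring.
have uVk0 : u 0 k0 * V k0 = - \sum_(k | k != k0) u 0 k * V k.
  by apply/eqP; rewrite -addr_eq0 -[X in _ == X]uV [in X in _ == X](bigD1 k0).
have Vk0 : V k0 = moment x y a (2 * m) m by rewrite /V subnK.
rewrite -(ler_pM2l uk0) -Vk0 -normrM uVk0 normrN.
apply: le_trans (ler_norm_sum _ _ _) _.
apply: (@le_trans _ _ (\sum_(k | k != k0) `|u 0 k0| * s)).
  apply: ler_sum => k kk0; rewrite normrM ler_pM //; first exact: k0max.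
  have km : (k <= m)%N by rewrite -ltnS.
  apply: Hs; first by rewrite mul2n -addnn leq_add ?leq_subr.
  apply: contraNneq kk0 => e; apply/eqP/val_inj/eqP => /=.
  by rewrite -(eqn_add2l (m - k0)) subnK // e.
by rewrite sumr_const cardC1 card_ord mulrCA mulr_natl lexx.
Qed.

(** Every non-central moment is at most the square root of the non-central part
    of the energy, because its binomial weight is at least 1. *)
Lemma energy_gap (C : numClosedFieldType) (N m : nat) (x y a : 'I_N -> C) :
  (0 < m)%N -> (N <= m)%N ->
  ('C(2 * m, m)%:R + m%:R ^- 2) * `|moment x y a (2 * m) m| ^+ 2
  <= energy x y a (2 * m).
Proof.
move=> m0 Nm.
have mP : (m < (2 * m).+1)%N by rewrite ltnS leq_pmull.
rewrite /energy (bigD1 (Ordinal mP)) //= mulrDl lerD2l.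
set S := \sum_(_ < _ | _) _.
have S0 : 0 <= S by apply: sumr_ge0 => j _; rewrite mulr_ge0 ?exprn_ge0.
rewrite ler_pdivrMl ?exprn_gt0 ?ltr0n //.
rewrite -[S]sqrtCK -exprMn ler_pXn2r ?nnegrE ?mulr_ge0 ?sqrtC_ge0 //.
apply: middle_moment_le => // j jm jNm.
rewrite -(@ler_pXn2r _ 2 isT) ?nnegrE ?sqrtC_ge0 // sqrtCK.
have jP : (j < (2 * m).+1)%N by [].
rewrite /S (bigD1 (Ordinal jP)) //=.
rewrite -[X in X <= _]addr0 lerD //.
  by rewrite ler_peMl ?exprn_ge0 // ler1n bin_gt0.
by apply: sumr_ge0 => i _; rewrite mulr_ge0 ?exprn_ge0.
Qed.

(** * The two-point inequality *)

Lemma half_expr_le (C : numClosedFieldType) (d e : C) (n : nat) :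
  0 <= e -> e <= d -> e ^+ n / 2 <= d ^+ n - e ^+ n / 2.
Proof.
move=> e0 ed; rewrite lerBrDr -mulrDr -div1r -splitr mulr1.
by apply: lerXn2r; rewrite ?nnegrE ?(le_trans e0 ed).
Qed.

Lemma exprB_half_ge0 (C : numClosedFieldType) (d e : C) (n : nat) :
  0 <= e -> e <= d -> 0 <= d ^+ n - e ^+ n / 2.
Proof.
move=> e0 ed; apply: le_trans (half_expr_le n e0 ed).
by rewrite divr_ge0 ?exprn_ge0 ?ler0n.
Qed.

(** The geometric mean of the diagonal entries dominates the off-diagonal entry
    of the 2 x 2 matrix (X^m - T^m / 2), where a^2, c^2 are the diagonal entries
    of X, p^2, q^2 those of T, and u^2, v^2 those of Y = X - T. With k1, k2
    the square roots of the diagonal entries at exponent m, Cauchy-Schwarz on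
    the diagonal reduces the induction step to
      (ac - |X|) k1 k2 >= (pq)^m (|Y| - uv) / 2,
    which follows from k1 k2 >= (pq)^m / 2 and |X| + |Y| <= ac + uv. The
    case m = 0 starts the induction with equality. *)
Lemma two_point_offdiag_le (C : numClosedFieldType) (X Y T a c p q u v : C) (m : nat) :
  0 <= a -> 0 <= c -> 0 <= p -> 0 <= q -> 0 <= u -> 0 <= v ->
  p <= a -> q <= c ->
  X - T = Y -> `|T| = p * q -> u ^+ 2 = a ^+ 2 - p ^+ 2 ->
  v ^+ 2 = c ^+ 2 - q ^+ 2 -> `|X| <= a * c -> `|X| + `|Y| <= a * c + u * v ->
  `|X ^+ m - T ^+ m / 2| <=
  sqrtC (a ^+ (2 * m) - p ^+ (2 * m) / 2) *
  sqrtC (c ^+ (2 * m) - q ^+ (2 * m) / 2).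
Proof.
move=> a0 c0 p0 q0 u0 v0 pa qc XT nT u2 v2 nX nXY.
have h0 : 0 <= 2^-1 :> C by rewrite invr_ge0 ler0n.
have pos := @exprB_half_ge0 C; have half := @half_expr_le C.
elim: m => [|m IHm].
  rewrite !muln0 !expr0 -expr2 sqrtCK ger0_norm //.
  by have := half 1 1 0 ler01 (lexx _); rewrite expr0; apply: le_trans; rewrite mulr_ge0.
set k1 := sqrtC _ in IHm; set k2 := sqrtC _ in IHm.
have k1_0 : 0 <= k1 by rewrite sqrtC_ge0 pos.
have k2_0 : 0 <= k2 by rewrite sqrtC_ge0 pos.
have pq0 : 0 <= (p * q) ^+ m / 2 by rewrite mulr_ge0 ?exprn_ge0 ?mulr_ge0.
have kpq : (p * q) ^+ m / 2 <= k1 * k2.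
  rewrite -(@ler_pXn2r _ 2 isT) ?nnegrE // ?mulr_ge0 // [leRHS]exprMn /k1 /k2 !sqrtCK.
  have -> : ((p * q) ^+ m / 2) ^+ 2 = (p ^+ (2 * m) / 2) * (q ^+ (2 * m) / 2).
    by rewrite !exprMn -!exprM [(m * 2)%N]mulnC; ring.
  by rewrite ler_pM ?half // mulr_ge0 ?exprn_ge0.
apply: (@le_trans _ _ (a * c * (k1 * k2) + (p * q) ^+ m / 2 * (u * v))).
  have -> : X ^+ m.+1 - T ^+ m.+1 / 2 = X * (X ^+ m - T ^+ m / 2) + T ^+ m / 2 * Y.
    by rewrite -XT !exprS; ring.
  apply: le_trans (ler_normD _ _) _.
  rewrite !normrM normrX nT [`|2^-1|]ger0_norm //.
  apply: (@le_trans _ _ (`|X| * (k1 * k2) + (p * q) ^+ m / 2 * `|Y|)).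
    by rewrite lerD2r ler_wpM2l.
  rewrite -subr_ge0.
  have -> : a * c * (k1 * k2) + (p * q) ^+ m / 2 * (u * v)
     - (`|X| * (k1 * k2) + (p * q) ^+ m / 2 * `|Y|)
     = (a * c - `|X|) * (k1 * k2 - (p * q) ^+ m / 2)
       + (p * q) ^+ m / 2 * (a * c + u * v - (`|X| + `|Y|)) by ring.
  by apply: addr_ge0; apply: mulr_ge0; rewrite ?subr_ge0.
rewrite -(@ler_pXn2r _ 2 isT) ?nnegrE; first last.
- by rewrite mulr_ge0 // sqrtC_ge0 pos.
- by rewrite addr_ge0 // mulr_ge0 // mulr_ge0.
(* Cauchy-Schwarz for the two summands of each diagonal entry; the difference
   of the two sides is a perfect square. *)
rewrite [leRHS]exprMn !sqrtCK -subr_ge0.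
have E (d e w : C) : w ^+ 2 = d ^+ 2 - e ^+ 2 -> 0 <= e -> e <= d ->
    d ^+ (2 * m.+1) - e ^+ (2 * m.+1) / 2 =
    d ^+ 2 * sqrtC (d ^+ (2 * m) - e ^+ (2 * m) / 2) ^+ 2
    + e ^+ (2 * m) / 2 * w ^+ 2.
  by move=> -> e0 ed; rewrite sqrtCK mulnS !exprD; field.
rewrite (E a p u) // (E c q v) // -/k1 -/k2.
have -> : (a ^+ 2 * k1 ^+ 2 + p ^+ (2 * m) / 2 * u ^+ 2) *
  (c ^+ 2 * k2 ^+ 2 + q ^+ (2 * m) / 2 * v ^+ 2) -
  (a * c * (k1 * k2) + (p * q) ^+ m / 2 * (u * v)) ^+ 2
  = (a * k1 * q ^+ m * v - c * k2 * p ^+ m * u) ^+ 2 / 2.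
  by rewrite !exprMn [(2 * m)%N]mulnC !exprM; field.
rewrite mulr_ge0 // real_exprn_even_ge0 // rpredB // ger0_real //;
  rewrite !mulr_ge0 // exprn_ge0 //.
Qed.

Lemma hermitian_form2_ge0 (C : numClosedFieldType) (k1 k2 z b d : C) :
  0 <= k1 -> 0 <= k2 -> `|z| <= k1 * k2 ->
  0 <= k1 ^+ 2 * b * b^* + z * b * d^* + (z^* * d * b^* + k2 ^+ 2 * d * d^*).
Proof.
move=> k1_0 k2_0 nz; pose t := z * b * d^*.
have -> : k1 ^+ 2 * b * b^* + z * b * d^* + (z^* * d * b^* + k2 ^+ 2 * d * d^* )
    = (k1 * `|b| - k2 * `|d|) ^+ 2 + (2 * (k1 * k2 * `|b| * `|d|) + (t + t^* )).
  have -> : t + t^* = z * b * d^* + z^* * b^* * d by rewrite !rmorphM /= conjCK.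
  rewrite sqrrB !exprMn !normCK; ring.
apply: addr_ge0.
  by rewrite real_exprn_even_ge0 // rpredB // ger0_real // mulr_ge0.
have tR : t + t^* \is Num.real by rewrite CrealE rmorphD /= conjCK addrC.
have nt : `|t + t^*| <= 2 * (k1 * k2 * `|b| * `|d|).
  apply: le_trans (ler_normD _ _) _; rewrite norm_conjC -mulr2n mulr_natl.
  rewrite lerMn2r /= /t !normrM norm_conjC.
  by do 2! rewrite ler_wpM2r //.
by rewrite -lerBlDl sub0r (real_lerNnormlW tR).
Qed.

(** For herm(z_i, z_l) = s + t with s, t its two coordinate products,
    X = (s + t)^2, T = 4st and Y = (s - t)^2. The bound |X| <= ac is
    Lagrange's identity; the parallelogram law turns |X| + |Y| into
    ac + (|x_0|^2 - |y_0|^2)(|x_1|^2 - |y_1|^2). *)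
Lemma two_point_energy (C : numClosedFieldType) (m : nat) (x y a : 'I_2 -> C) :
  2 ^+ (2 * m) / 2 * `|moment x y a (2 * m) m| ^+ 2 <= energy x y a (2 * m).
Proof.
pose X i l := (x i * (x l)^* + y i * (y l)^* ) ^+ 2.
pose Y i l := (x i * (x l)^* - y i * (y l)^* ) ^+ 2.
pose T i l := 4 * ((x i * (x l)^* ) * (y i * (y l)^* )).
pose K i l := X i l ^+ m - T i l ^+ m / 2.
have -> : 2 ^+ (2 * m) / 2 * `|moment x y a (2 * m) m| ^+ 2 =
    \sum_i \sum_l T i l ^+ m / 2 * a i * (a l)^*.
  rewrite sqr_norm_moment mulr_sumr; apply: eq_bigr => i _.
  rewrite mulr_sumr; apply: eq_bigr => l _.
  have -> : (2 * m - m = m)%N by rewrite mul2n -addnn addnK.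
  by rewrite /T !exprMn exprM (_ : 2 ^+ 2 = 4); [ring | rewrite -natrX].
rewrite -subr_ge0 energyE -sumrB.
under eq_bigr => i _.
  rewrite -sumrB; under eq_bigr => l _ do rewrite exprM -!mulrBl -/(K i l).
  over.
rewrite !big_ord_recl !big_ord0 !addr0.
set i0 : 'I_2 := ord0; set i1 : 'I_2 := lift ord0 ord0.
pose r i := `|x i| ^+ 2 + `|y i| ^+ 2.
pose p i := 2 * (`|x i| * `|y i|).
pose u i := `| `|x i| ^+ 2 - `|y i| ^+ 2|.
have r0 i : 0 <= r i by rewrite addr_ge0 ?exprn_ge0.
have p0 i : 0 <= p i by rewrite mulr_ge0 ?ler0n ?mulr_ge0.
have dR i : `|x i| ^+ 2 - `|y i| ^+ 2 \is Num.real.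
  by rewrite rpredB // rpredX // normr_real.
have u2 i : u i ^+ 2 = r i ^+ 2 - p i ^+ 2.
  by rewrite real_normK // /r /p; ring.
have pr i : p i <= r i.
  by rewrite -(@ler_pXn2r _ 2 isT) ?nnegrE // -subr_ge0 -u2 exprn_ge0 ?normr_ge0.
have Kii i : K i i = sqrtC (r i ^+ (2 * m) - p i ^+ (2 * m) / 2) ^+ 2.
  rewrite sqrtCK /K /X /T -!normCK !exprM; congr (_ - _ ^+ m / 2).
  by rewrite /p; ring.
have K10 : K i1 i0 = (K i0 i1)^*.
  rewrite /K /X /T rmorphB rmorphM fmorphV !rmorphXn rmorphD !rmorphM /=.
  by rewrite !conjCK !rmorph_nat ![(_ i1) * _]mulrC.
rewrite K10 !Kii; apply: hermitian_form2_ge0; last first.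
  apply: (@two_point_offdiag_le _ _ (Y i0 i1) _ _ _ _ _ (u i0) (u i1)) => //.
  - by rewrite normr_ge0.
  - by rewrite normr_ge0.
  - by rewrite /X /Y /T; ring.
  - by rewrite /T /p !normrM !norm_conjC normr_nat; ring.
  - rewrite /X normrX -subr_ge0.
    suff -> : r i0 * r i1 - `|x i0 * (x i1)^* + y i0 * (y i1)^*| ^+ 2
            = `|x i0 * y i1 - y i0 * x i1| ^+ 2 by rewrite exprn_ge0.
    by rewrite /r !normCK !(rmorphD, rmorphN, rmorphM) /= !conjCK; ring.
  - have -> : `|X i0 i1| + `|Y i0 i1| = r i0 * r i1 +
      (`|x i0| ^+ 2 - `|y i0| ^+ 2) * (`|x i1| ^+ 2 - `|y i1| ^+ 2).
      rewrite /X /Y !normrX /r !normCK !(rmorphD, rmorphN, rmorphM) /= !conjCK.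
      by ring.
    by rewrite lerD2l /u -normrM real_ler_norm // rpredM.
all: by rewrite sqrtC_ge0 exprB_half_ge0.
Qed.

Lemma one_point_energy (C : numClosedFieldType) (m : nat) (x y a : 'I_1 -> C) :
  2 ^+ (2 * m) * `|moment x y a (2 * m) m| ^+ 2 <= energy x y a (2 * m).
Proof.
rewrite energyE /moment !big_ord1; set i := ord0.
have -> : (2 * m - m = m)%N by rewrite mul2n -addnn addnK.
rewrite -[leRHS]mulrA -!normCK !normrM !normrX.
have -> : 2 ^+ (2 * m) * (`|a i| * `|x i| ^+ m * `|y i| ^+ m) ^+ 2 =
    (2 * (`|x i| * `|y i|)) ^+ (2 * m) * `|a i| ^+ 2.
  by rewrite !exprMn -!exprM [(m * 2)%N]mulnC; ring.
rewrite ler_wpM2r ?exprn_ge0 //; apply: lerXn2r; rewrite ?nnegrE.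
- by rewrite mulr_ge0 ?ler0n ?mulr_ge0.
- by rewrite addr_ge0 ?exprn_ge0.
rewrite -subr_ge0.
have -> : `|x i| ^+ 2 + `|y i| ^+ 2 - 2 * (`|x i| * `|y i|) =
          (`|x i| - `|y i|) ^+ 2 by ring.
by rewrite real_exprn_even_ge0 // rpredB // normr_real.
Qed.

(** * The kernels R_lambda *)

Lemma differentiable_exprn (K : numFieldType) (V : normedModType K)
    (f : V -> K) (n : nat) (p : V) :
  differentiable f p -> differentiable (fun q => f q ^+ n) p.
Proof.
case: n => [|n] df; first exact: differentiable_cst.
rewrite (_ : (fun q => f q ^+ n.+1) = f ^+ n.+1); first exact: differentiableX.
by apply/funext => q; rewrite fctE.
Qed.

Lemma differentiable_fst_coord (K : numFieldType) (n : nat)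
    (p : 'rV[K]_n * 'rV[K]_n) (i : 'I_n) :
  differentiable (fun q : 'rV[K]_n * 'rV[K]_n => q.1 0 i) p.
Proof.
apply: (@differentiable_comp _ _ _ _ fst (fun N : 'rV[K]_n => N 0 i)).
  apply: linear_differentiable => x; exact: cvg_fst.
exact: differentiable_coord.
Qed.

Lemma differentiable_snd_coord (K : numFieldType) (n : nat)
    (p : 'rV[K]_n * 'rV[K]_n) (i : 'I_n) :
  differentiable (fun q : 'rV[K]_n * 'rV[K]_n => q.2 0 i) p.
Proof.
apply: (@differentiable_comp _ _ _ _ snd (fun N : 'rV[K]_n => N 0 i)).
  apply: linear_differentiable => x; exact: cvg_snd.
exact: differentiable_coord.
Qed.

Lemma calP0_Rlam (R : realType) (m : nat) (lambda : R) : calP0 (Rlam m lambda).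
Proof.
split=> [p|z w]; last first.
  rewrite /Rlam /herm rmorphB rmorphM !rmorphXn rmorphD !rmorphM /= !conjCK.
  have -> : ((lambda%:C)%C)^* = (lambda%:C)%C by exact: conjc_real.
  by congr (_ ^+ _ - _ * _ ^+ _); ring.
rewrite /Rlam /herm.
under eq_fun do rewrite !mxE !conjCK.
have d1 := @differentiable_fst_coord R[i] 2 p.
have d2 := @differentiable_snd_coord R[i] 2 p.
apply: differentiableB.
  apply: differentiable_exprn; apply: differentiableD; exact: differentiableM.
apply: differentiableM; first exact: differentiable_cst.
apply: differentiable_exprn.
by do 3?[apply: differentiableM => //].
Qed.

(** Membership in P_0 is automatic, so only positivity depends on lambda; the
    binomial formula then turns it into a comparison of moments. *)
Lemma calP_RlamE (R : realType) (m k : nat) (lambda : R) :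
  calP k (Rlam m lambda) <->
  forall x y a : 'I_k -> R[i],
    (lambda%:C)%C * `|moment x y a (2 * m) m| ^+ 2 <= energy x y a (2 * m).
Proof.
have E x y a (z : 'I_k -> 'rV[R[i]]_2) :
    (forall i, z i 0 0 = x i) -> (forall i, z i 0 1 = y i) ->
    \sum_(i < k) \sum_(j < k) Rlam m lambda (z i) (z j) * a i * (a j)^* =
    energy x y a (2 * m) - (lambda%:C)%C * `|moment x y a (2 * m) m| ^+ 2.
  move=> zx zy; rewrite energyE sqr_norm_moment mulr_sumr -sumrB.
  apply: eq_bigr => i _; rewrite mulr_sumr -sumrB; apply: eq_bigr => l _.
  rewrite /Rlam /herm !zx !zy (_ : (2 * m - m = m)%N); last by lia.
  by rewrite !exprMn; ring.
split=> [[_ H] x y a | H].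
  rewrite -subr_ge0 -(E _ _ _ (fun i => \row_j if j == 0 then x i else y i)) //.
  - by move=> i; rewrite mxE.
  - by move=> i; rewrite mxE.
split; first exact: calP0_Rlam.
by move=> z a; rewrite (E (fun i => z i 0 0) (fun i => z i 0 1)) // subr_ge0.
Qed.

Lemma calP_bound (R : realType) (m k : nat) (lambda : R) : (0 < k)%N ->
  calP k (Rlam m lambda) ->
  lambda <= (\sum_(j < (2 * m).+1 | j == m %[mod k]) 'C(2 * m, j))%:R.
Proof.
move=> k0 /calP_RlamE /(root_of_unity_bound k0).
by rewrite -natr_sum -(rmorph_nat (real_complex R)) lecR.
Qed.

Lemma calP_of_bound (R : realType) (m k : nat) (lambda b : R) :
  (forall x y a : 'I_k -> R[i],
     (b%:C)%C * `|moment x y a (2 * m) m| ^+ 2 <= energy x y a (2 * m)) ->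
  lambda <= b -> calP k (Rlam m lambda).
Proof.
move=> H lb; apply/calP_RlamE => x y a; apply: le_trans (H x y a).
by rewrite ler_wpM2r ?exprn_ge0 // lecR.
Qed.

Lemma calPoo_RlamE (R : realType) (m : nat) (lambda : R) :
  calPoo (Rlam m lambda) <-> lambda <= 'C(2 * m, m)%:R.
Proof.
split=> [/(_ m.+1 isT) /(calP_bound (ltn0Sn m))|lam k _].
  by rewrite sum_bin_mod_gt.
apply: calP_of_bound lam => x y a.
by rewrite rmorph_nat energy_ge_mid.
Qed.

Theorem theorem3 (R : realType) (m : nat) (hm : (0 < m)%N) :
  (forall lambda : R, calP 1 (Rlam m lambda) <-> lambda <= 2 ^+ (2 * m)) /\
  (forall lambda : R, calP 2 (Rlam m lambda) <-> lambda <= 2 ^+ (2 * m - 1)) /\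
  (forall lambda : R, calPoo (Rlam m lambda) <-> lambda <= 'C(2 * m, m)%:R) /\
  (forall (k : nat) (lambda : R), (m < k)%N ->
     (calP k (Rlam m lambda) <-> calPoo (Rlam m lambda))) /\
  (forall lambda : R, calP m (Rlam m lambda) -> lambda <= 'C(2 * m, m)%:R + 2) /\
  stability_index (Sfam R m) = Some m.+1.
Proof.
have stable k (lambda : R) : (m < k)%N ->
    calP k (Rlam m lambda) <-> calPoo (Rlam m lambda).
  move=> mk; have k0 := leq_ltn_trans (leq0n m) mk.
  split=> [/(calP_bound k0)|/(_ k k0) //].
  by rewrite sum_bin_mod_gt // => /calPoo_RlamE.
split=> [lambda|].
  split=> [/(calP_bound (ltn0Sn 0))|].
    rewrite (eq_bigl predT) => [|j]; last by rewrite !modn1.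
    rewrite natr_sum -[2]/(1 + 1) exprDn; congr (_ <= _); apply: eq_bigr => j _.
    by rewrite !expr1n mul1r.
  apply: calP_of_bound => x y a; rewrite rmorphXn /= rmorph_nat.
  exact: one_point_energy.
split=> [lambda|].
  split=> [/(calP_bound (ltn0Sn 1))|].
    by rewrite sum_bin_parity // natrX.
  apply: calP_of_bound => x y a; rewrite rmorphXn /= rmorph_nat.
  rewrite (_ : 2 ^+ (2 * m - 1) = 2 ^+ (2 * m) / 2); first exact: two_point_energy.
  by rewrite expfB ?expr1 //; lia.
split=> [lambda|]; first exact: calPoo_RlamE.
split=> //.
split=> [lambda /(calP_bound hm) lam|].
  by apply: le_trans lam _; rewrite -[2]/(2%:R) -natrD ler_nat sum_bin_mod_eq.
have Sstable k : (m < k)%N -> Sfam R m `&` calP k = Sfam R m `&` calPoo.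
  move=> mk; apply/seteqP; split=> K [[lambda _ <-] HK];
    by split; [exists lambda | exact/(stable _ _ mk)].
have unstable k : (0 < k)%N -> (k <= m)%N ->
    Sfam R m `&` calP k <> Sfam R m `&` calPoo.
  (* This value exceeds the threshold of P_oo but is within the gap for m points. *)
  move=> k0 km E; pose lambda : R := 'C(2 * m, m)%:R + m%:R ^- 2.
  have : (Sfam R m `&` calP k) (Rlam m lambda).
    split; first by exists lambda.
    apply: calP_of_bound (lexx lambda) => x y a.
    rewrite rmorphD fmorphV rmorphXn !rmorph_nat; exact: energy_gap.
  rewrite E => -[_ /calPoo_RlamE].
  by rewrite /lambda gerDl leNgt invr_gt0 exprn_gt0 // ltr0n.
rewrite /stability_index; case: pselect => [ex|]; last first.
  by case; exists m.+1; apply/asboolP/Sstable.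
congr Some; case: ex_minnP => k /andP[k0 /asboolP Ek] kmin.
apply/eqP; rewrite eqn_leq kmin ?ltnNge; last by apply/asboolP/Sstable.
by apply/negP => km; exact: unstable Ek.
Qed.
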